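(* Let $X \subset Y=[a,b]_{\mathbb{Z}} \times [c,d]_{\mathbb{Z}} \subset \mathbb{Z}^2$ be such that $X$ is digitally convex. Then $(X,c_2)$ has the approximate fixed point property (AFPP).
   Context: $[a,b]_{\mathbb{Z}}$ denotes $\{z\in\mathbb{Z} \mid a\le z\le b\}$. Adjacency: for distinct $x=(x_1,x_2), y=(y_1,y_2)\in\mathbb{Z}^2$ and $u\in\{1,2\}$, $x$ and $y$ are $c_u$-adjacent if $|x_i-y_i|=1$ for at most $u$ indices $i$, and $x_j=y_j$ for every index $j$ with $|x_j-y_j|\ne 1$ (so $c_1$ is 4-adjacency and $c_2$ is 8-adjacency). A set $A\subset\mathbb{Z}^2$ is $\kappa$-connected if any two of its points are joined by a finite sequence of points of $A$ in which consecutive points are $\kappa$-adjacent; $\kappa$-components are maximal $\kappa$-connected subsets. AFPP: $(X,c_2)$ denotes $X$ with the $c_2$ adjacency. A function $f:X\to X$ is $c_2$-continuous if whenever $x,x'\in X$ are $c_2$-adjacent, $f(x)$ and $f(x')$ are $c_2$-adjacent or equal. $(X,c_2)$ has the AFPP if for every $c_2$-continuous $f:X\to X$ there is $x\in X$ such that $f(x)$ is $c_2$-adjacent or equal to $x$. Disks: a $c_2$-closed curve is a set $S=\{s_i\}_{i=0}^{m-1}\subset\mathbb{Z}^2$ of pairwise distinct points with $s_i$ $c_2$-adjacent to $s_{(i+1)\bmod m}$ for $0\le i\le m-1$. If $S$ is a $c_2$-closed curve such that $\mathbb{Z}^2\setminus S$ has exactly two $c_1$-components, one finite and the other infinite, then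 the finite one is denoted $Int(S)$, the set $D=S\cup Int(S)$ is a (digital) disk, and $S$ is a bounding curve of $D$. Convexity: a (digital) line segment is a set of $n>1$ collinear points of $\mathbb{Z}^2$ that is $\kappa$-connected for some $\kappa\in\{c_1,c_2\}$ (necessarily horizontal, vertical, or of slope $\pm1$). A finite set $X\subset\mathbb{Z}^2$ is (digitally) convex if it is a single point, or a digital line segment, or a digital disk with a bounding curve $S$ such that the endpoints of the maximal digital line segments of $S$ are the vertices of the convex hull of $X$ in $\mathbb{R}^2$. *)

(* Defs.v *)
From HB Require Import structures.
From mathcomp Require Import all_boot all_order all_algebra.
From mathcomp Require Import boolp classical_sets functions cardinality.
From mathcomp Require Import set_interval reals convex.

Set Implicit Arguments.
Unset Strict Implicit.
Unset Printing Implicit Defensive.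

Import Order.TTheory GRing.Theory Num.Theory.

Local Open Scope classical_set_scope.
Local Open Scope ring_scope.

Definition Z2 : Type := (int * int)%type.

(* c_u-adjacency; the booleans counting the coordinates at distance 1 are
   coerced to nat. *)
Definition adj (u : nat) : rel Z2 := fun x y =>
  [&& x != y,
      ((`|x.1 - y.1| == 1%R) + (`|x.2 - y.2| == 1%R) <= u)%N,
      (`|x.1 - y.1| != 1) ==> (x.1 == y.1) &
      (`|x.2 - y.2| != 1) ==> (x.2 == y.2)].

Definition adjeq (u : nat) (x y : Z2) : bool := adj u x y || (x == y).

Definition dconnected (u : nat) (A : set Z2) : Prop :=
  forall x y, A x -> A y ->
    exists p : seq Z2,
      [/\ path (adj u) x p, last x p = y & [set` x :: p] `<=` A].

Definition dcomponent (u : nat) (A C : set Z2) : Prop :=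
  [/\ C `<=` A, dconnected u C &
      forall C', C' `<=` A -> dconnected u C' -> C `<=` C' -> C' = C].

(* A self-map of X is a map on Z2 sending X to X; its values outside X play
   no role. *)
Definition dcontinuous (u : nat) (X : set Z2) (f : Z2 -> Z2) : Prop :=
  forall x x', X x -> X x' -> adj u x x' -> adjeq u (f x) (f x').

Definition AFPP (u : nat) (X : set Z2) : Prop :=
  forall f : Z2 -> Z2, set_fun X X f -> dcontinuous u X f ->
    exists2 x, X x & adjeq u (f x) x.

Definition closed_curve (s : seq Z2) : Prop :=
  [/\ (0 < size s)%N, uniq s & cycle (adj 2) s].

(* The complement of s has exactly two c_1-components, a finite one I, which
   is then Int(s), and an infinite one. *)
Definition curve_interior (s : seq Z2) (I : set Z2) : Prop :=
  finite_set I /\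
  exists2 E : set Z2, infinite_set E &
    forall C, dcomponent 1 (~` [set` s]) C <-> C = I \/ C = E.

Definition bounding_curve (s : seq Z2) (D : set Z2) : Prop :=
  closed_curve s /\
  exists2 I : set Z2, curve_interior s I & D = [set` s] `|` I.

Definition collinear (A : set Z2) : Prop :=
  forall p q r, A p -> A q -> A r ->
    (q.1 - p.1) * (r.2 - p.2) = (q.2 - p.2) * (r.1 - p.1).

Definition dsegment (A : set Z2) : Prop :=
  [/\ exists2 n : nat, (1 < n)%N & (A #= `I_n)%card,
      collinear A & dconnected 1 A \/ dconnected 2 A].

(* A segment of a curve is made of consecutive points of it. With arbitrary
   subsets of the curve instead, {(0,1),(1,0)} would be a maximal digital line
   segment of the boundary of [0,n] x [0,n] (n >= 2), and no square would be convex. *)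
Definition subarc (s t : seq Z2) : Prop := exists i, prefix t (rot i s).

Definition curve_segment (s t : seq Z2) : Prop :=
  subarc s t /\ dsegment [set` t].

Definition max_curve_segment (s t : seq Z2) : Prop :=
  curve_segment s t /\
  forall t', curve_segment s t' -> [set` t] `<=` [set` t'] ->
    [set` t'] = [set` t].

Definition segment_endpoint (s : seq Z2) (p : Z2) : Prop :=
  exists x t, max_curve_segment s (x :: t) /\ (p = x \/ p = last x t).

Section RealPlane.
Variable R : realType.

Definition plane : lmodType R := (R^o * R^o)%type.

Definition embed (p : Z2) : plane := (p.1%:~R, p.2%:~R).

Definition convex_hull (A : set plane) : set plane :=
  smallest (@convex_set R plane) A.

Definition extreme_point (K : set plane) (p : plane) : Prop :=
  K p /\
  forall x y (t : R), K x -> K y -> 0 < t < 1 ->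
    p = t *: x + (1 - t) *: y -> x = p /\ y = p.

(* The vertices of a convex polygon are its extreme points. *)
Definition hull_vertices (X : set Z2) : set plane :=
  extreme_point (convex_hull (embed @` X)).

Definition digitally_convex (X : set Z2) : Prop :=
  finite_set X /\
  [\/ exists p, X = [set p],
      dsegment X |
      exists2 s, bounding_curve s X &
        embed @` segment_endpoint s = hull_vertices X].

End RealPlane.

(* Main.v *)
(** Convexity plays no role: what matters is that [X] is [c_2]-connected and
    that, unless it is a segment, its complement is [c_1]-connected. Such a set
    is dismantlable: as long as it has two points, some [v] in it has a
    neighbour [u] adjacent or equal to all neighbours of [v], and removing [v]
    preserves both properties. The approximate fixed point property passes from
    [X :\ v] to [X].

    To find [v], take the topmost leftmost point. If it is not dominated, then
    its south-west neighbour and its east or south-east neighbour are in [X]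
    while its south neighbour [S] is not. A [c_2]-path in [X] joining the first
    two and avoiding the point would close up to a curve around [S], which is
    impossible because [S] escapes to infinity in the complement. Hence the
    point is a cut point, and one continues with a piece that it cuts off. *)
Require Import Defs.
From mathcomp Require Import all_boot all_order all_algebra.
From mathcomp Require Import boolp classical_sets functions cardinality.
From mathcomp Require Import set_interval reals convex.
From mathcomp Require Import zify.

Set Implicit Arguments.
Unset Strict Implicit.
Unset Printing Implicit Defensive.

Import Order.TTheory GRing.Theory Num.Theory.

Local Open Scope classical_set_scope.
Local Open Scope ring_scope.


(** * Adjacency in coordinates, and steps crossing a vertical ray *)

Lemma adj2E x y : adj 2 x y =
  [&& (x.1 != y.1) || (x.2 != y.2), `|x.1 - y.1| <= 1 & `|x.2 - y.2| <= 1].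
Proof. case: x y => [x1 x2] [y1 y2]; rewrite /adj /= xpair_eqE; lia. Qed.

Lemma adj1E x y : adj 1 x y = (`|x.1 - y.1| + `|x.2 - y.2| == 1).
Proof. case: x y => [x1 x2] [y1 y2]; rewrite /adj /= xpair_eqE; lia. Qed.

(* The step from [a] to [b] crosses the vertical ray going up from [z], moved
   slightly to the right so that it avoids all lattice points. *)
Definition crosses (z a b : Z2) : bool :=
  [&& a.1 == z.1, b.1 == z.1 + 1 & z.2 < a.2] ||
  [&& b.1 == z.1, a.1 == z.1 + 1 & z.2 < b.2].

(** Raising the origin of the ray by one removes a single lattice point from the column above it,
    and the step avoids that point. *)
Lemma crosses_vert (z a b : Z2) : a != (z.1, z.2 + 1) -> b != (z.1, z.2 + 1) ->
  crosses z a b = crosses (z.1, z.2 + 1) a b.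
Proof.
case: z a b => [z1 z2] [a1 a2] [b1 b2]; rewrite /crosses /= !xpair_eqE.
by case: (eqVneq a1 z1) => ha; case: (eqVneq b1 z1) => hb;
  rewrite ?andbF /=; lia.
Qed.

(** The rays at [z] and at its east neighbour enclose the half-column above that neighbour. A step
    avoiding both origins crosses exactly one of the rays when it enters or leaves this half-column.
    Modulo 2 the two crossing counts thus differ by a coboundary. *)
Lemma crosses_horiz (z a b : Z2) : adj 2 a b ->
    a != z -> b != z -> a != (z.1 + 1, z.2) -> b != (z.1 + 1, z.2) ->
  crosses z a b (+) crosses (z.1 + 1, z.2) a b =
  ((a.1 == z.1 + 1) && (z.2 < a.2)) (+) ((b.1 == z.1 + 1) && (z.2 < b.2)).
Proof.
case: z a b => [z1 z2] [a1 a2] [b1 b2]; rewrite adj2E /crosses /= !xpair_eqE.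
case/and3P=> _; rewrite !ler_norml => /andP[h1 h2] /andP[h3 h4].
by case: (eqVneq a1 z1) => ?; case: (eqVneq b1 z1) => ?;
  case: (eqVneq a1 (z1 + 1)) => ?; case: (eqVneq b1 (z1 + 1)) => ? /=; try lia;
  case: (ltP z2 a2) => ?; case: (ltP z2 b2) => ?; lia.
Qed.


(** * Connection by paths, and the crossing parity of closed walks *)

Lemma adj_sym u : symmetric (adj u).
Proof.
move=> x y; rewrite /adj (eq_sym x y) (eq_sym x.1 y.1) (eq_sym x.2 y.2).
rewrite !(distrC x.1 y.1) !(distrC x.2 y.2).
by rewrite (distnC x.1 y.1) (distnC x.2 y.2).
Qed.

Definition conn u (A : set Z2) (x y : Z2) : Prop :=
  exists p, [/\ path (adj u) x p, last x p = y & [set` x :: p] `<=` A].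

Lemma conn_refl u (A : set Z2) x : A x -> conn u A x x.
Proof. by move=> Ax; exists [::]; split=> // y /=; rewrite inE => /eqP->. Qed.

Lemma conn_step u (A : set Z2) x y : A x -> A y -> adj u x y -> conn u A x y.
Proof.
move=> Ax Ay xy; exists [:: y]; split=> //=; first by rewrite xy.
by move=> z /=; rewrite !inE => /orP[]/eqP->.
Qed.

Lemma conn_trans u (A : set Z2) y x z :
  conn u A x y -> conn u A y z -> conn u A x z.
Proof.
case=> p [xp yE pA] [q [yq zE qA]]; exists (p ++ q).
split; rewrite ?cat_path ?last_cat ?xp ?yE //.
move=> t /=; rewrite -cat_cons mem_cat => /orP[tp|tq]; first exact: pA.
by apply: qA => /=; rewrite inE tq orbT.
Qed.

Lemma conn_sym u (A : set Z2) x y : conn u A x y -> conn u A y x.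
Proof.
case=> p [xp <- pA]; exists (rev (belast x p)); split.
- by rewrite rev_path; apply: sub_path xp => a b; rewrite adj_sym.
- by case: p {xp pA} => //= a p; rewrite rev_cons last_rcons.
- move=> t /= tp; apply: pA; move: tp => /=.
  by rewrite (lastI x p) mem_rcons !in_cons mem_rev.
Qed.

Lemma conn_sub u (A B : set Z2) x y : A `<=` B -> conn u A x y -> conn u B x y.
Proof. by move=> AB [p [xp yE pA]]; exists p; split=> // t /pA /AB. Qed.

Lemma conn_end u (A : set Z2) x y : conn u A x y -> A y.
Proof. by case=> p [_ <- pA]; apply: pA; exact: mem_last. Qed.

Fixpoint step_parity (f : rel Z2) (x : Z2) (p : seq Z2) : bool :=
  if p is y :: q then f x y (+) step_parity f y q else false.

Lemma step_parity_cat f x p q :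
  step_parity f x (p ++ q) = step_parity f x p (+) step_parity f (last x p) q.
Proof. by elim: p x => //= y p IHp x; rewrite IHp addbA. Qed.

Lemma step_parity0 (f : rel Z2) (A : set Z2) x p :
    (forall a b, A a -> A b -> f a b = false) -> [set` x :: p] `<=` A ->
  step_parity f x p = false.
Proof.
move=> f0; elim: p x => //= y p IHp x pA; rewrite f0 ?IHp //.
- by move=> t /= ty; apply: pA; rewrite /= inE ty orbT.
- by apply: pA; rewrite /= inE eqxx.
- by apply: pA; rewrite /= !inE eqxx orbT.
Qed.

(** The potential [U] cancels at every intermediate point of the walk. On a closed walk the
    right-hand side vanishes, so [f] and [g] have the same parity. *)
Lemma step_parity_telescope (f g : rel Z2) (U : pred Z2) (A : set Z2) x p :
    (forall a b, A a -> A b -> adj 2 a b -> f a b (+) g a b = U a (+) U b) ->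
    path (adj 2) x p -> [set` x :: p] `<=` A ->
  step_parity f x p (+) step_parity g x p = U x (+) U (last x p).
Proof.
move=> fg; elim: p x => [x _ _|y p IHp x /= /andP[xy yp] pA].
  by rewrite /= addbb.
rewrite addbACA IHp //; last first.
  by move=> t /= ty; apply: pA; rewrite /= inE ty orbT.
rewrite fg //; first by rewrite -addbA [U y (+) _]addbA addbb addFb.
- by apply: pA; rewrite /= inE eqxx.
- by apply: pA; rewrite /= !inE eqxx orbT.
Qed.

Lemma adj1_cases (P : Z2 -> Z2 -> Prop) : (forall z z', P z z' -> P z' z) ->
    (forall z, P z (z.1, z.2 + 1)) -> (forall z, P z (z.1 + 1, z.2)) ->
  forall z z', adj 1 z z' -> P z z'.
Proof.
move=> Psym Pv Ph [z1 z2] [t1 t2]; rewrite adj1E /= => zt.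
have [[-> ->]|[[-> ->]|[[-> ->]|[-> ->]]]] :
  (t1 = z1 /\ t2 = z2 + 1) \/ (z1 = t1 /\ z2 = t2 + 1) \/
  (t1 = z1 + 1 /\ t2 = z2) \/ (z1 = t1 + 1 /\ z2 = t2) by lia.
- exact: (Pv (z1, z2)).
- exact/Psym/(Pv (t1, t2)).
- exact: (Ph (z1, z2)).
- exact/Psym/(Ph (t1, t2)).
Qed.

Section ClosedWalk.
Variables (A : set Z2) (x : Z2) (p : seq Z2).
Hypotheses (xp : path (adj 2) x p) (px : last x p = x).
Hypothesis pA : [set` x :: p] `<=` A.

(** A discrete form of the local constancy of the winding number modulo 2. The potential is zero for
    a vertical move of [z], and the indicator of the half-column for a horizontal one. *)
Lemma crosses_parity_step z z' : adj 1 z z' -> ~ A z -> ~ A z' ->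
  step_parity (crosses z) x p = step_parity (crosses z') x p.
Proof.
have neq t a : ~ A t -> A a -> a != t by move=> nAt Aa; apply/eqP => at_; subst.
move: z z'; apply: adj1_cases => [z z' zz' ? ?|z nz nz'|z nz nz'].
- by rewrite zz'.
- apply: (@addIb (step_parity (crosses (z.1, z.2 + 1)) x p)); rewrite addbb.
  rewrite (@step_parity_telescope _ _ xpred0 A) // => a b Aa Ab _.
  by rewrite crosses_vert ?addbb //; apply: neq.
- apply: (@addIb (step_parity (crosses (z.1 + 1, z.2)) x p)); rewrite addbb.
  rewrite (@step_parity_telescope _ _
    (fun t => (t.1 == z.1 + 1) && (z.2 < t.2)) A) ?px ?addbb // => a b Aa Ab ab.
  by rewrite crosses_horiz //; apply: neq.
Qed.

Lemma crosses_parity_conn z z' : conn 1 (~` A) z z' ->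
  step_parity (crosses z) x p = step_parity (crosses z') x p.
Proof.
case=> q [+ <-]; elim: q z => [//|t q IHq z] /andP[zt tq] qA.
have nz : ~ A z by apply: qA; rewrite /= inE eqxx.
have tqA : [set` t :: q] `<=` ~` A.
  by move=> s /= sq; apply: qA; rewrite /= inE sq orbT.
have nt : ~ A t by apply: tqA; rewrite /= inE eqxx.
rewrite (crosses_parity_step zt nz nt); exact: IHq tq tqA.
Qed.

End ClosedWalk.

Lemma bounded_above (X : seq Z2) : exists h : int, forall x, x \in X -> x.2 < h.
Proof.
elim: X => [|a X [h hX]]; first by exists 0.
exists (Num.max h (a.2 + 1)) => x; rewrite inE => /orP[/eqP->|/hX xh];
  by rewrite lt_max ?xh ?ltrDl ?orbT.
Qed.

(** The point [z] can be moved through the complement to a point above all of [X], whose ray meets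
    no step of the walk. *)
Lemma crosses_parity0 (X : seq Z2) x p z : dconnected 1 (~` [set` X]) ->
    path (adj 2) x p -> last x p = x -> {subset x :: p <= X} -> z \notin X ->
  step_parity (crosses z) x p = false.
Proof.
move=> cX xp px pX zX; have [h hX] := bounded_above X.
have hN : ~ [set` X] (0, h) by move=> /= /hX /=; rewrite ltxx.
rewrite (@crosses_parity_conn [set` X] x p xp px _ z (0, h)) //; last first.
  by apply: cX => //; apply/negP.
apply: (@step_parity0 _ [set` X]) => // a b /= /hX ah /hX bh.
by rewrite /crosses /= !(ltNge h) (ltW ah) (ltW bh) /= !andbF.
Qed.


(** * Topmost points, domination and pieces cut off by a point *)

Definition below (p q : Z2) : bool :=
  (p.2 < q.2) || ((p.2 == q.2) && (q.1 <= p.1)).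

Lemma below_column z v : below z v -> z != v -> z.1 = v.1 -> z.2 <= v.2 - 1.
Proof.
case: z v => [z1 z2] [v1 v2]; rewrite /below xpair_eqE /= => zv + zE.
by move: zv; rewrite zE eqxx /=; lia.
Qed.

(** [below] is a total order: rows are read upwards, each from right to left. Its greatest element
    is the topmost point, leftmost in its row. *)
Lemma below_max (c : Z2) (A : seq Z2) :
  exists2 v, v \in c :: A & forall p, p \in c :: A -> below p v.
Proof.
elim: A => [|a A [v vA vmax]].
  exists c; rewrite ?inE ?eqxx // => p; rewrite inE => /eqP->.
  by rewrite /below eqxx lexx orbT.
have [vc|] := boolP (below a v).
  exists v => [|p]; first by move: vA; rewrite !inE => /orP[]->; rewrite ?orbT.
  rewrite !inE orbCA => /orP[/eqP->//|pA]; apply: vmax; by rewrite inE.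
move=> nav; exists a => [|p]; first by rewrite !inE eqxx orbT.
rewrite !inE orbCA => /orP[/eqP->|pA]; first by rewrite /below eqxx lexx orbT.
have {vmax} := vmax p; rewrite inE => /(_ pA).
by move: nav; rewrite /below; lia.
Qed.

(** This is the condition under which moving [v] to [u] and fixing every other point of [X] is
    $c_2$-continuous. *)
Definition dominated (X : seq Z2) (v : Z2) : Prop :=
  exists u, [/\ u \in X, adj 2 u v &
    forall y, y \in X -> adj 2 v y -> adjeq 2 u y].

Lemma top_dominated (X : seq Z2) v y0 : y0 \in X -> adj 2 v y0 ->
    (forall y, y \in X -> adj 2 v y -> below y v) ->
  dominated X v \/
  exists a b, [/\ a \in X, b \in X, (v.1, v.2 - 1) \notin X,
    a = (v.1 - 1, v.2 - 1) &
    b = (v.1 + 1, v.2) \/ b = (v.1 + 1, v.2 - 1)].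
Proof.
move=> y0X vy0 top; set s := (v.1, v.2 - 1); set a := (v.1 - 1, v.2 - 1).
have cases y : y \in X -> adj 2 v y ->
    [\/ y = s, y = a, y = (v.1 + 1, v.2) | y = (v.1 + 1, v.2 - 1)].
  move=> yX vy; have := top y yX vy; move: vy; rewrite adj2E /below /s /a.
  case: y {yX} => y1 y2 /= vy yv.
  have : (y1 = v.1 /\ y2 = v.2 - 1) \/ (y1 = v.1 - 1 /\ y2 = v.2 - 1) \/
    (y1 = v.1 + 1 /\ y2 = v.2) \/ (y1 = v.1 + 1 /\ y2 = v.2 - 1) by lia.
  case=> [[-> ->]|[[-> ->]|[[-> ->]|[-> ->]]]];
    [exact: Or41|exact: Or42|exact: Or43|exact: Or44].
have near x y : `|x.1 - y.1| <= 1 -> `|x.2 - y.2| <= 1 -> adjeq 2 x y.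
  move=> h1 h2; rewrite /adjeq adj2E h1 h2 !andbT.
  by case: x y {h1 h2} => [x1 x2] [y1 y2]; rewrite xpair_eqE /=; lia.
(* The south point [s] is at distance at most 1 from all four possible neighbours. *)
have [sX|sX] := boolP (s \in X).
  left; exists s; split=> //; first by rewrite adj2E /s /=; lia.
  move=> y yX vy.
  by case: (cases y yX vy) => ->; apply: near; rewrite /s /a /=; clear; lia.
(* Without [s] and [a] only the east and south-east points remain. They are adjacent to each other,
   so any neighbour of [v] dominates it. *)
have [aX|aX] := boolP (a \in X); last first.
  left; exists y0; split=> //; first by rewrite adj_sym.
  have east y : y \in X -> adj 2 v y ->
      y = (v.1 + 1, v.2) \/ y = (v.1 + 1, v.2 - 1).
    move=> yX vy; case: (cases y yX vy) => yE; [ | |by left|by right].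
    - by rewrite yE (negPf sX) in yX.
    - by rewrite yE (negPf aX) in yX.
  move=> y yX vy; case: (east _ y0X vy0) => ->;
    case: (east _ yX vy) => ->; apply: near => /=; clear; lia.
have [[b [bX bE]]|nb] := pselect (exists b, b \in X /\
    (b = (v.1 + 1, v.2) \/ b = (v.1 + 1, v.2 - 1))).
  by right; exists a, b; split.
left; exists a; split=> //; first by rewrite adj2E /a /=; lia.
move=> y yX vy; case: (cases y yX vy) => yE.
- by rewrite yE (negPf sX) in yX.
- by rewrite yE /adjeq eqxx orbT.
- by case: nb; exists y; split=> //; left.
- by case: nb; exists y; split=> //; right.
Qed.

(* [A] is a union of pieces that [c] cuts off from the rest of [X]. *)
Definition pendant (X A : seq Z2) (c : Z2) : Prop :=
  [/\ A != [::], {subset c :: A <= X}, c \notin A &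
    forall a y, a \in A -> y \in X -> adj 2 a y -> y \in c :: A].

(** If [v] is not dominated, it separates its south-west neighbour from its eastern one within
    [c :: A]. At least one of the two is then cut off from [c] as well, and its piece is pendant at
    [v]. *)
Lemma pendant_top (X A : seq Z2) c v : dconnected 1 (~` [set` X]) ->
    (forall x, x \in X -> exists2 y, y \in X & adj 2 x y) ->
    pendant X A c -> v \in A -> (forall p, p \in c :: A -> below p v) ->
  dominated X v \/ exists A' c', pendant X A' c' /\ (size A' < size A)%N.
Proof.
move=> cX nX [A0 AX cA clA] vA top.
have vX : v \in X by apply: AX; rewrite inE vA orbT.
have [y0 y0X vy0] := nX v vX.
have [|[a [b [aX bX sX aE bE]]]] := top_dominated y0X vy0
  (fun y yX vy => top y (clA v y vA yX vy)).
  by left.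
right; set s := (v.1, v.2 - 1) in sX.
pose B : set Z2 := [set p | p \in c :: A /\ p != v].
have va : adj 2 v a by rewrite aE adj2E /=; clear; lia.
have vb : adj 2 v b by case: bE => ->; rewrite adj2E /=; clear; lia.
have inB y : y \in X -> adj 2 v y -> B y.
  move=> yX vy; split; first exact: clA vA yX vy.
  by apply: contraTneq vy => ->; rewrite /adj eqxx.
have Ba := inB a aX va; have Bb := inB b bX vb.
(* A path from [a] to [b] in [B] closes up through [v]. Points of [B] in the column of [v] lie at or
   below [s], and the step from [v] to [a] goes west, so the ray above [s] is crossed only by the
   final step from [b] to [v]. The parity is odd, a contradiction. *)
have nab : ~ conn 2 B a b.
  case=> q [aq qb qB].
  have walk : path (adj 2) v (a :: rcons q v).
    by rewrite /= va rcons_path aq qb adj_sym vb.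
  have wX : {subset v :: a :: rcons q v <= X}.
    move=> t; rewrite in_cons -rcons_cons mem_rcons in_cons orbA orbb.
    by case/orP=> [/eqP->//|/qB[] /AX].
  have := crosses_parity0 cX walk _ wX sX.
  rewrite /= last_rcons => /(_ erefl); rewrite -cats1 step_parity_cat qb.
  rewrite (@step_parity0 _ B) //=; last first.
    move=> x y Bx By.
    have low z : B z -> (z.1 == v.1) && (v.2 - 1 < z.2) = false.
      case=> zA zv; apply/negP => /andP[/eqP zE].
      by rewrite ltNge (below_column (top z zA)).
    apply/negP => /orP[]/and3P[xv _ yv].
      by have := low x Bx; rewrite xv yv.
    by have := low y By; rewrite xv yv.
  have -> : crosses s v a = false by rewrite /crosses /s aE /=; clear; lia.
  suff -> : crosses s b v by [].
  by case: bE => ->; rewrite /crosses /s /=; clear; lia.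
have [o [Bo vo noc]] : exists o, [/\ B o, adj 2 v o & ~ conn 2 B o c].
  have [ac|] := pselect (conn 2 B a c); last by exists a.
  exists b; split=> // bc; apply: nab; exact: conn_trans ac (conn_sym bc).
have oc : o \in A.
  case: (Bo) => + _; rewrite in_cons => /orP[/eqP oE|//]; case: noc.
  by rewrite -oE; exact: conn_refl.
(* The new piece is the class of [o] in [B]. It is strictly smaller than [A] because it misses
   [v]. *)
exists [seq t <- A | `[< conn 2 B o t >]], v; split.
  split.
  - rewrite -size_eq0 -lt0n size_filter -has_count; apply/hasP; exists o => //.
    by apply/asboolP; exact: conn_refl.
  - move=> t; rewrite inE mem_filter => /orP[/eqP->//|/andP[_ tA]].
    by apply: AX; rewrite inE tA orbT.
  - rewrite mem_filter; apply/negP => /andP[/asboolP /conn_end [_]].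
    by rewrite eqxx.
  - move=> t y; rewrite mem_filter => /andP[/asboolP ot tA] yX ty.
    rewrite inE mem_filter; have [//|yv] := eqVneq y v.
    have yA := clA t y tA yX ty; have By : B y by [].
    have oy := conn_trans ot (conn_step (conn_end ot) By ty).
    rewrite asboolT //=; move: yA; rewrite inE => /orP[/eqP yc|//].
    by rewrite yc in oy.
rewrite size_filter -(count_predC (fun t => `[< conn 2 B o t >]) A).
rewrite -addn1 leq_add2l -has_count; apply/hasP; exists v => //=.
by apply/asboolPn => /conn_end [_]; rewrite eqxx.
Qed.


(** * Point reflection, and existence of a dominated point *)

Definition reflect0 (p : Z2) : Z2 := (- p.1, - p.2).

Lemma reflect0K : involutive reflect0.
Proof. by case=> p1 p2; rewrite /reflect0 /= !opprK. Qed.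

Lemma adj_reflect0 u p q : adj u (reflect0 p) (reflect0 q) = adj u p q.
Proof.
rewrite /adj (inj_eq (inv_inj reflect0K)) /reflect0 /=.
by rewrite -!opprD !normrN !eqr_opp !abszN.
Qed.

Lemma mem_reflect0 (X : seq Z2) p : (p \in map reflect0 X) = (reflect0 p \in X).
Proof. by rewrite -{1}(reflect0K p) (mem_map (inv_inj reflect0K)). Qed.

Lemma dconnected_reflect0 u (A : set Z2) :
  dconnected u A -> dconnected u (reflect0 @^-1` A).
Proof.
move=> cA x y Ax Ay; have [p [xp py pA]] := cA _ _ Ax Ay.
exists (map reflect0 p); split.
- rewrite -[x]reflect0K path_map.
  by apply: sub_path xp => a b; rewrite /= adj_reflect0.
- by rewrite -[x]reflect0K last_map py reflect0K.
- move=> t; rewrite /= -[x]reflect0K -map_cons mem_reflect0; exact: pA.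
Qed.

Lemma dominated_reflect0 (X : seq Z2) v :
  dominated (map reflect0 X) v -> dominated X (reflect0 v).
Proof.
case=> u [uX uv uN]; exists (reflect0 u); split; first by rewrite -mem_reflect0.
  by rewrite adj_reflect0.
move=> y yX vy; have := uN (reflect0 y); rewrite mem_reflect0 reflect0K.
rewrite -{1}[v]reflect0K adj_reflect0 => /(_ yX vy).
rewrite /adjeq -{1}[u]reflect0K adj_reflect0 => /orP[->//|/eqP->].
by rewrite reflect0K eqxx orbT.
Qed.

Lemma pendant_reflect0 (X A : seq Z2) c : pendant X A c ->
  pendant (map reflect0 X) (map reflect0 A) (reflect0 c).
Proof.
case=> A0 AX cA clA; split.
- by case: (A) A0.
- by move=> t; rewrite -map_cons !mem_reflect0; exact: AX.
- by rewrite mem_reflect0 reflect0K.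
- move=> a y; rewrite -map_cons !mem_reflect0 => aA yX ay.
  by apply: clA aA yX _; rewrite adj_reflect0.
Qed.

Lemma below_anti a b : below a b -> below b a -> a = b.
Proof.
case: a b => [a1 a2] [b1 b2]; rewrite /below /= => h1 h2.
by congr pair; lia.
Qed.

Lemma below_reflect0 a b : below (reflect0 a) (reflect0 b) = below b a.
Proof. by rewrite /below /= ltrN2 lerN2 eqr_opp eq_sym. Qed.

(** Induction on the size of the piece. [pendant_top] requires the topmost point to differ from [c];
    otherwise a reflection through the origin, which reverses [below], restores this. *)
Lemma exists_dominated_pendant (X A : seq Z2) c : dconnected 1 (~` [set` X]) ->
    (forall x, x \in X -> exists2 y, y \in X & adj 2 x y) -> pendant X A c ->
  exists2 v, v \in X & dominated X v.
Proof.
have [n] := ubnP (size A); elim: n X A c => // n IHn X A c sA cX nX pA.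
have [A0 AX cA clA] := pA.
have [v vA vtop] := below_max c A.
have [vc|vc] := eqVneq v c; last first.
  have {}vA : v \in A by move: vA; rewrite inE (negPf vc).
  have [?|[A' [c' [pA' sA']]]] := pendant_top cX nX pA vA vtop.
    by exists v => //; apply: AX; rewrite inE vA orbT.
  by apply: (IHn X A' c') => //; exact: leq_trans sA' _.
(* The topmost leftmost point is [c], so the bottommost rightmost one is not. *)
have cX' : dconnected 1 (~` [set` map reflect0 X]).
  have -> : ~` [set` map reflect0 X] = reflect0 @^-1` (~` [set` X]).
    by apply/seteqP; split=> t /=; rewrite mem_reflect0.
  exact: dconnected_reflect0.
have nX' x : x \in map reflect0 X ->
    exists2 y, y \in map reflect0 X & adj 2 x y.
  rewrite mem_reflect0 => /nX[y yX xy]; exists (reflect0 y).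
    by rewrite mem_reflect0 reflect0K.
  by rewrite -[x]reflect0K adj_reflect0.
suff [w wX dw] : exists2 w, w \in map reflect0 X & dominated (map reflect0 X) w.
  by exists (reflect0 w); [rewrite -mem_reflect0|exact: dominated_reflect0].
have [w wA wtop] := below_max (reflect0 c) (map reflect0 A).
have pA' := pendant_reflect0 pA; have [_ AX' _ _] := pA'.
have {}wA : w \in map reflect0 A.
  move: wA; rewrite inE => /orP[/eqP wc|//].
  case: (A) A0 (cA) vtop wtop => // a A1 _; rewrite inE negb_or.
  move=> /andP[/eqP ca _] vtop wtop; case: ca; apply: below_anti; last first.
    by rewrite -vc; apply: vtop; rewrite !inE eqxx orbT.
  by rewrite -below_reflect0 -wc; apply: wtop; rewrite /= !inE eqxx orbT.
have [dw|[A' [c' [pA2 sA']]]] := pendant_top cX' nX' pA' wA wtop.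
  by exists w => //; apply: AX'; rewrite inE wA orbT.
apply: (IHn _ A' c') => //; rewrite size_map in sA'; exact: leq_trans sA' _.
Qed.

(** * Removal of a dominated point *)

Lemma conn_neighbor (X : seq Z2) x y : conn 2 [set` X] x y -> x != y ->
  exists2 z, z \in X & adj 2 x z.
Proof.
case=> [[|z p]] [/= + py pX]; first by rewrite py eqxx.
by case/andP=> xz _ _; exists z => //; apply: pX; rewrite /= !inE eqxx orbT.
Qed.

Section Retract.
Variables (X : seq Z2) (u v : Z2).
Hypotheses (vX : v \in X) (uX : u \in X) (uv : adj 2 u v).
Hypothesis uN : forall y, y \in X -> adj 2 v y -> adjeq 2 u y.

Let r (x : Z2) := if x == v then u else x.
Let Xv := [seq x <- X | x != v].

Let rX x : x \in X -> r x \in Xv.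
Proof.
rewrite /r mem_filter; case: (eqVneq x v) => [_ _|xv xX]; last by rewrite xv.
by rewrite uX andbT; apply: contraTneq uv => ->; rewrite /adj eqxx.
Qed.

Let r_adj x y : x \in X -> y \in X -> adjeq 2 x y -> adjeq 2 (r x) (r y).
Proof.
rewrite /r.
case: (eqVneq x v) => [->|xv]; case: (eqVneq y v) => [->|yv] xX yX xy.
- by rewrite /adjeq eqxx orbT.
- by move: xy; rewrite /adjeq (eq_sym v) (negPf yv) orbF; exact: uN.
- move: xy; rewrite /adjeq (negPf xv) orbF adj_sym => /(uN xX).
  by rewrite /adjeq adj_sym eq_sym.
- by [].
Qed.

Lemma retract_nil : Xv != [::].
Proof. by have := rX uX; case: Xv. Qed.

Lemma retract_size : (size Xv < size X)%N.
Proof.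
rewrite size_filter -(count_predC (fun x => x != v) X) -addn1 leq_add2l.
by rewrite -has_count; apply/hasP; exists v => //=; rewrite eqxx.
Qed.

(** The map [r] sends a path in [X] to a path in [Xv], up to steps that stay in place. *)
Lemma retract_conn : dconnected 2 [set` X] -> dconnected 2 [set` Xv].
Proof.
move=> cX x y /= xX yX.
have rE z : z \in Xv -> r z = z by rewrite mem_filter /r => /andP[/negPf->].
have inX z : z \in Xv -> z \in X by rewrite mem_filter => /andP[].
have [p [xp py pX]] := cX x y (inX _ xX) (inX _ yX).
rewrite -(rE _ xX) -(rE _ yX) -py {xX yX py y}.
elim: p x xp pX => [|a p IHp] x.
  by move=> _ pX; apply: conn_refl; apply: rX; apply: pX; exact: mem_head.
move=> /= /andP[xa ap] pX.
have xX : x \in X by apply: pX; exact: mem_head.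
have apX : [set` a :: p] `<=` [set` X].
  by move=> t ta; apply: pX; rewrite /= inE ta orbT.
have aX : a \in X by apply: apX; exact: mem_head.
have /orP[xa'|/eqP->] : adjeq 2 (r x) (r a).
- by apply: r_adj => //; rewrite /adjeq xa.
- by apply: conn_trans (IHp a ap apX); apply: conn_step xa'; exact: rX.
- exact: IHp.
Qed.

Lemma retract_compl : dconnected 1 (~` [set` X]) -> dconnected 1 (~` [set` Xv]).
Proof.
move=> cX.
have XvX : ~` [set` X] `<=` ~` [set` Xv].
  by move=> t tX /=; rewrite mem_filter => /andP[_].
(* If all four $c_1$-neighbours of [v] were in [X], then [u] would be within distance 1 of each of
   them, which forces [u = v]. Hence [v] is attached to the old complement through some [z]. *)
have [z zX vz] : exists2 z, z \notin X & adj 1 v z.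
  apply: contrapT => noz.
  have all4 z : adj 1 v z -> adjeq 2 u z.
    move=> vz; have [zX|zX] := boolP (z \in X).
      by apply: uN => //; move: vz; rewrite adj1E adj2E; lia.
    by case: noz; exists z.
  have near z : adj 1 v z -> (`|u.1 - z.1| <= 1) && (`|u.2 - z.2| <= 1).
    move=> /all4 /orP[|/eqP->]; last by rewrite !subrr normr0.
    by rewrite adj2E => /and3P[_ -> ->].
  have := near (v.1 + 1, v.2); have := near (v.1 - 1, v.2).
  have := near (v.1, v.2 + 1); have := near (v.1, v.2 - 1).
  move: uv; rewrite !adj1E adj2E /=; lia.
have vv : (~` [set` Xv]) v by move=> /=; rewrite mem_filter eqxx.
have toz t : (~` [set` Xv]) t -> conn 1 (~` [set` Xv]) t z.
  have [-> _|tv tX] := eqVneq t v.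
    by apply: conn_step vz => //; apply: XvX; apply/negP.
  apply: conn_sub XvX _; apply: cX; last exact/negP.
  by move=> tX'; apply: tX; rewrite /= mem_filter tv.
by move=> s t sX tX; apply: conn_trans (toz s sX) (conn_sym (toz t tX)).
Qed.

(* If [x] is an approximate fixed point of [r \o f] but not of [f], then
   [f x = v], so [u = r (f x)] is near [x] and hence [r (f u)] is near [u]:
   [u] is an approximate fixed point of [f]. *)
Lemma retract_AFPP : AFPP 2 [set` Xv] -> AFPP 2 [set` X].
Proof.
move=> afpp f fX fc.
have XvX z : z \in Xv -> z \in X by rewrite mem_filter => /andP[].
have fc' x y : x \in X -> y \in X -> adjeq 2 x y -> adjeq 2 (f x) (f y).
  move=> xX yX /orP[xy|/eqP->]; first exact: fc.
  by rewrite /adjeq eqxx orbT.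
have [x /= xX gx] : exists2 x, [set` Xv] x & adjeq 2 (r (f x)) x.
  apply: afpp => [x /= xX|x y /= xX yX xy].
    by apply: rX; apply: fX; exact: XvX.
  have [{}xX {}yX] := (XvX x xX, XvX y yX).
  by apply: r_adj; [exact: fX|exact: fX|exact: fc].
have [{}xX xXv] := (XvX x xX, xX).
have [fxv|fxv] := eqVneq (f x) v; last first.
  by exists x => //; move: gx; rewrite /r (negPf fxv).
exists u => //.
have [fuv|fuv] := eqVneq (f u) v; first by rewrite fuv /adjeq adj_sym uv.
have := r_adj (fX u uX) (fX x xX) (fc' u x uX xX _).
move: gx; rewrite /r fxv eqxx (negPf fuv) => ux; exact.
Qed.

End Retract.

(** Induction on the size of [X], for any class [P] stable under removal of dominated points. It
    serves both simply connected sets and segments. *)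
Lemma dismantle_AFPP (P : seq Z2 -> Prop) :
    (forall X, P X -> X != [::] /\ dconnected 2 [set` X]) ->
    (forall X, P X -> (forall x, x \in X -> exists2 y, y \in X & adj 2 x y) ->
       exists2 v, v \in X & dominated X v) ->
    (forall X u v, P X -> v \in X -> u \in X -> adj 2 u v ->
       (forall y, y \in X -> adj 2 v y -> adjeq 2 u y) ->
       P [seq x <- X | x != v]) ->
  forall X, P X -> AFPP 2 [set` X].
Proof.
move=> Pc Pdom Pdel X; have [n] := ubnP (size X); elim: n X => // n IHn X sX PX.
have [X0 cX] := Pc X PX.
have [nX|one] := pselect (forall x, x \in X -> exists2 y, y \in X & adj 2 x y).
  have [v vX [u [uX uv uN]]] := Pdom X PX nX.
  apply: (retract_AFPP uX uv uN); apply: IHn; last exact: Pdel uN.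
  exact: leq_trans (retract_size vX) _.
(* An isolated point of a connected set is its only point, so [f] fixes it. *)
have [x xX xN] : exists2 x, x \in X & forall y, y \in X -> ~~ adj 2 x y.
  apply: contrapT => nx; apply: one => x xX; apply: contrapT => ny.
  by apply: nx; exists x => // y yX; apply/negP => xy; apply: ny; exists y.
move=> f fX _; exists x => //; rewrite /adjeq.
have [->|fx] := eqVneq (f x) x; first by rewrite orbT.
have [||y yX xy] := @conn_neighbor X x (f x).
- by apply: cX => //; exact: fX.
- by rewrite eq_sym.
- by have := xN y yX; rewrite xy.
Qed.

Lemma simply_connected_AFPP (X : seq Z2) : X != [::] ->
  dconnected 2 [set` X] -> dconnected 1 (~` [set` X]) -> AFPP 2 [set` X].
Proof.
move=> X0 cX ccX; pose P X := [/\ X != [::], dconnected 2 [set` X] &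
  dconnected 1 (~` [set` X])].
apply: (@dismantle_AFPP P) => {X X0 cX ccX} // [X []//|X [X0 cX ccX] nX|X u v].
  case: X X0 cX ccX nX => // c X _ cX ccX nX.
  (* The induction starts from all of [X] except one arbitrary point [c]. *)
  apply: (@exists_dominated_pendant _ [seq x <- c :: X | x != c] c) => //.
  have [y yX cy] := nX c (mem_head _ _).
  have yc : y != c by apply: contraTneq cy => ->; rewrite /adj eqxx.
  split.
  - rewrite -size_eq0 -lt0n size_filter -has_count; apply/hasP; by exists y.
  - move=> t; rewrite inE => /orP[/eqP->|]; first exact: mem_head.
    by rewrite mem_filter => /andP[].
  - by rewrite mem_filter eqxx.
  - move=> a t _ tX _; rewrite in_cons mem_filter tX andbT; exact: orbN.
move=> [X0 cX ccX] vX uX uv uN; split.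
- exact: retract_nil uX uv.
- exact: retract_conn uX uv uN _.
- exact: retract_compl uv uN _.
Qed.

Lemma collinear_AFPP (X : seq Z2) : X != [::] ->
  dconnected 2 [set` X] -> collinear [set` X] -> AFPP 2 [set` X].
Proof.
move=> X0 cX lX; pose P X := [/\ X != [::], dconnected 2 [set` X] &
  collinear [set` X]].
apply: (@dismantle_AFPP P) => {X X0 cX lX} // [X []//|X [X0 cX lX] nX|X u v].
  case: X X0 cX lX nX => // c X _ cX lX nX.
  have [v vX vtop] := below_max c X; exists v => //.
  have [y yX vy] := nX v vX.
  have [//|[a [b [aX bX _ aE bE]]]] :=
    top_dominated yX vy (fun t tX _ => vtop t tX).
  (* An undominated topmost point has a south-west and an eastern neighbour, and these three points
     are not collinear. *)
  have := lX v a b vX aX bX; rewrite aE.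
  by case: bE => -> /=; lia.
move=> [X0 cX lX] vX uX uv uN; split.
- exact: retract_nil uX uv.
- exact: retract_conn uX uv uN _.
- move=> p q s; rewrite /= !mem_filter => /andP[_ ?] /andP[_ ?] /andP[_ ?].
  exact: lX.
Qed.


(** * Components and digital disks *)

Lemma path_conn u (A : set Z2) x p t :
  path (adj u) x p -> [set` x :: p] `<=` A -> t \in x :: p -> conn u A x t.
Proof.
move=> xp pA; rewrite in_cons => /orP[/eqP->|tp].
  by apply: conn_refl; apply: pA; exact: mem_head.
case/path.splitP: tp xp pA => p1 p2; rewrite cat_path => /andP[xp1 _] pA.
exists (rcons p1 t); split; rewrite ?last_rcons // => z zp.
by apply: pA; rewrite /= -cat_cons mem_cat zp.
Qed.

Lemma conn_class u (A : set Z2) x y :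
  conn u A x y -> conn u [set t | conn u A x t] x y.
Proof.
by case=> p [xp <- pA]; exists p; split=> // t; exact: path_conn xp pA.
Qed.

Lemma dconnected_class u (A : set Z2) x : dconnected u [set t | conn u A x t].
Proof.
move=> y z /conn_class xy /conn_class; apply: conn_trans; exact: conn_sym.
Qed.

Lemma dcomponent_class u (A : set Z2) x :
  A x -> dcomponent u A [set t | conn u A x t].
Proof.
move=> Ax; split; [by move=> t; exact: conn_end|exact: dconnected_class|].
move=> C CA cC xC; apply/seteqP; split=> // t Ct.
by apply: conn_sub CA _; apply: cC => //; apply: xC; exact: conn_refl.
Qed.

(** Components, defined by maximality, are the classes of the relation [conn]; two components
    sharing a point are therefore equal. *)
Lemma dcomponentE u (A C : set Z2) x :
  dcomponent u A C -> C x -> C = [set t | conn u A x t].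
Proof.
case=> CA cC maxC Cx; apply/esym/maxC; last first.
- by move=> t Ct; apply: conn_sub CA _; exact: cC.
- exact: dconnected_class.
- by move=> t; exact: conn_end.
Qed.

Section Disk.
Variables (s : seq Z2) (I : set Z2).
Hypotheses (scurve : closed_curve s) (sI : curve_interior s I).

(** The complement of the disk is the infinite component [E]: a common point of [E] and [I] would
    make them equal, although only one is finite. *)
Lemma disk_compl_connected : dconnected 1 (~` ([set` s] `|` I)).
Proof.
have [finI [E infE comp]] := sI.
have cE : dcomponent 1 (~` [set` s]) E by apply/comp; right.
have cI : dcomponent 1 (~` [set` s]) I by apply/comp; left.
have outE t : (~` ([set` s] `|` I)) t -> E t.
  move=> nt; have nts : (~` [set` s]) t by move=> ?; apply: nt; left.
  have tt := conn_refl 1 nts.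
  have /comp[tI|<-//] := dcomponent_class 1 nts.
  by case: nt; right; rewrite -tI.
have [Es conE _] := cE.
move=> x y /outE Ex /outE Ey; apply: conn_sub (conE x y Ex Ey).
move=> t Et [/(Es _ Et)//|It].
by apply: infE; rewrite (dcomponentE cE Et) -(dcomponentE cI It).
Qed.

Lemma disk_connected : dconnected 2 ([set` s] `|` I).
Proof.
set D := _ `|` _.
have [a as_ aS] : exists2 a, a \in s & forall t, t \in s -> conn 2 D a t.
  have [+ _ +] := scurve; rewrite {}/D; case: (s) => [//|a p] _ /= cyc.
  exists a => [|t tp]; first exact: mem_head.
  apply: path_conn cyc _ _ => [z /= zp|]; last first.
    by rewrite in_cons mem_rcons tp orbT.
  by left; move: zp; rewrite in_cons mem_rcons /= in_cons orbA orbb.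
have aI z : I z -> conn 2 D a z.
  move=> Iz; have [finI [E _ comp]] := sI; apply/conn_sym.
  have cI : dcomponent 1 (~` [set` s]) I by apply/comp; left.
  have [l lE] : exists l : seq Z2, I = [set` l] by exact/finite_seqP.
  have [h hI] := bounded_above l.
  (* From [z] one moves straight up. Until the curve is met the points stay in [I], which lies below
     height [h], so at most [n] steps are possible. *)
  have [n zn] : exists n : nat, h <= z.2 + n%:Z.
    exists `|h - z.2|%N; lia.
  elim: n z Iz zn => [|n IHn] z Iz zn.
    move: Iz (hI z); rewrite lE /= => zl /(_ zl); rewrite ltNge; case/negP; lia.
  pose z' : Z2 := (z.1, z.2 + 1).
  have z1z' : adj 1 z z' by rewrite adj1E /=; lia.
  have z2z' : adj 2 z z' by rewrite adj2E /=; lia.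
  have Dz : D z by right.
  have [z's|z's] := boolP (z' \in s).
    have Dz' : D z' by left.
    exact: conn_trans (conn_step Dz Dz' z2z') (conn_sym (aS _ z's)).
  have Iz' : I z'.
    rewrite (dcomponentE cI Iz); apply: conn_step => //; last exact/negP.
    by case: cI => + _ _; apply.
  have Dz' : D z' by right.
  apply: conn_trans (conn_step Dz Dz' z2z') _; apply: IHn => //=; lia.
have aD z : D z -> conn 2 D a z by case; [exact: aS|exact: aI].
by move=> y z /aD ay /aD; apply: conn_trans; exact: conn_sym.
Qed.

End Disk.

Lemma dconnected12 (A : set Z2) : dconnected 1 A -> dconnected 2 A.
Proof.
move=> cA x y Ax Ay; have [p [xp py pA]] := cA x y Ax Ay; exists p; split=> //.
by apply: sub_path xp => a b; rewrite adj1E adj2E; lia.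
Qed.

Theorem theorem3p2 (R : realType) (a b c d : int) (X : set Z2)
    (XY : X `<=` `[a, b] `*` `[c, d]) (cX : digitally_convex R X) :
  AFPP 2 X.
Proof.
case: cX => /finite_seqP[l ->]; case=> [[p lp]|lseg|[s [scurve [I sI DE]] _]].
- rewrite lp => f fp _; exists p => //.
  by rewrite (fp p) // /adjeq eqxx orbT.
- have [[n n1 ln] coll conn_l] := lseg.
  apply: collinear_AFPP => //; last by case: conn_l => // /dconnected12.
  apply/eqP => l0; move: ln; rewrite l0 set_nil => /card_esym.
  by rewrite card_eq0 => /eqP/seteqP[+ _] => /(_ 0%N); apply; exact: ltnW.
- have cD := disk_connected scurve sI; have ccD := disk_compl_connected sI.
  rewrite -DE in cD ccD; apply: simply_connected_AFPP => //.
  apply/eqP => l0; have [s0 _ _] := scurve.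
  case: s s0 DE {scurve sI cD ccD} => // p s _; rewrite l0 set_nil => DE.
  suff : (set0 : set Z2) p by [].
  by rewrite DE; left; exact: mem_head.
Qed.
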